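(* Let $G$ be a locally finite, infinite connected graph with a finite set of source nodes $S$, and let $T=\emptyset$. Assume that $(G^{(n)})_{n\ge1}$ exhausts $G$. Then, for all $x\ge 0$, $$\lim_{n\to\infty}\mathbf P\left[\mathfrak S_c\big(G^{(n)}\big)\ge x\right]=\operatorname{perc}_S(e^{-x}).$$
   Context: Continuous-time cutting model. Let $H$ be a finite simple connected graph with nonempty source set $S\subseteq V(H)$ and target set $T_H\subseteq V(H)$. Equip the vertices with i.i.d. $\mathrm{Exp}(1)$ clocks $(X_v)$. Start from $H$ at time $0$; at each time $X_v$, if $v$ is still present, delete $v$ and its incident edges and discard all connected components containing no source. Let $H_t$ be the graph at time $t$ (after any cut made at time $t$). Then $\mathfrak S_c(H)=\inf\{t\ge0:V(H_t)\cap T_H=\emptyset\}$. Exhausting sequence. Let $G$ be a locally finite, infinite connected graph and $S,T\subseteq V(G)$. A sequence $(G^{(n)})_{n\ge1}$ of finite induced subgraphs exhausts $G$ if: the $G^{(n)}$ are connected, $G^{(1)}\subseteq G^{(2)}\subseteq\dots\subseteq G$ and $\bigcup_n V(G^{(n)})=V(G)$; and $S\subseteq V(G^{(n)})$ for all $n$ ($S$ being the set of sources of $G^{(n)}$), while $G^{(n)}$ is endowed with the target set $T^{(n)}=(T\cap V(G^{(n)}))\cup\partial_\emptyset(G\setminus G^{(n)})$, where $\partial_\emptyset(G\setminus G^{(n)})$ is the set of vertices of $G^{(n)}$ having a neighbour in $V(G)\setminus V(G^{(n)})$. Percolation. In $\mathrm{Ber}(p)$-site percolation on $G$, $p\in[0,1]$,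 each vertex is independently kept with probability $p$ and otherwise removed. $\operatorname{perc}_S(p)$ is the probability that the resulting random induced subgraph has an infinite connected component (cluster) containing at least one vertex of $S$. *)

(* Defs.v *)
From mathcomp Require Import all_boot all_order all_algebra finmap.
From mathcomp Require Import all_classical all_reals all_analysis.

Set Implicit Arguments.
Unset Strict Implicit.
Unset Printing Implicit Defensive.

Import Order.TTheory GRing.Theory Num.Theory.
Import numFieldTopology.Exports.

Local Open Scope classical_set_scope.
Local Open Scope ring_scope.

(* A simple graph on the vertex type V is a symmetric irreflexive adj : rel V;
   a subgraph always means an induced one, so it is given by its vertices. *)
Definition connected_graph (V : eqType) (adj : rel V) : Prop :=
  forall u v : V, exists2 p : seq V, path adj u p & last u p = v.

Definition locally_finite (V : eqType) (adj : rel V) : Prop :=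
  forall v : V, finite_set [set w | adj v w].

Definition induced_adj (V : choiceType) (adj : rel V) (A : {fset V}) : rel A :=
  [rel u v | adj (val u) (val v)].
Arguments induced_adj {V} adj A.

(* Cutting a finite graph e on W, with sources S, according to clocks x. *)
Section Cutting.
Variables (R : realType) (W : finType) (e : rel W) (S : {set W}).

(* Keep the components of the subgraph induced by A that contain a source. *)
Definition prune (A : {set W}) : {set W} :=
  [set v in A | [exists s in S :&: A,
     connect [rel a b | [&& a \in A, b \in A & e a b]] s v]]%SET.

Definition cut (A : {set W}) (v : W) : {set W} :=
  if v \in A then prune (A :\ v)%SET else A.

(* The vertex set of H_t: all clocks rung up to and including time t are
   processed in increasing order (ties have probability 0 for i.i.d.
   exponential clocks, and are processed one vertex at a time). *)
Definition remaining (x : W -> R) (t : R) : {set W} :=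
  foldl cut [set: W]%SET
    (sort (fun u v => x u <= x v) [seq v <- enum W | x v <= t]).

(* The set below is bounded below by 0, and nonempty as soon as W has a vertex:
   it contains every t >= 0 by which all clocks have rung. *)
Definition separation_time (T : {set W}) (x : W -> R) : R :=
  inf [set t : R | 0 <= t /\ [disjoint remaining x t & T]%B].

End Cutting.

Record exhausts (V : choiceType) (adj : rel V) (S : set V)
    (U : nat -> {fset V}) : Prop := Exhausts {
  exhausts_connected : forall n, connected_graph (induced_adj adj (U n));
  exhausts_mono : forall n, (U n `<=` U n.+1)%fset;
  exhausts_cover : forall v : V, exists n, v \in U n;
  exhausts_source : forall n, S `<=` [set` U n] }.

Definition source_set (V : choiceType) (S : set V) (A : {fset V}) : {set A} :=
  [set v : A | val v \in S]%SET.

(* The prescribed targets lying in A, together with the inner boundary of A. *)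
Definition target_set (V : choiceType) (adj : rel V) (T : set V)
    (A : {fset V}) : {set A} :=
  [set v : A | (val v \in T) ||
     `[< exists2 w : V, w \notin A & adj (val v) w >]]%SET.

Section Iid.
Variables (R : realType) (d d' : measure_display) (Omega : measurableType d)
  (E : measurableType d') (P : probability Omega R).

Definition mutually_independent (I : choiceType) (X : I -> {RV P >-> E}) :
    Prop :=
  forall (J : {fset I}) (B : I -> set E), (forall i, measurable (B i)) ->
    P (\bigcap_(i in [set` J]) (X i @^-1` B i)) =
    (\prod_(i <- J) P (X i @^-1` B i))%E.

Definition iid (I : choiceType) (X : I -> {RV P >-> E})
    (mu : set E -> \bar R) : Prop :=
  (forall i (B : set E), measurable B -> distribution P (X i) B = mu B) /\
  mutually_independent X.

End Iid.

(* The component of s in the subgraph induced by the set K of kept vertices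
   (empty when s is not kept). *)
Definition cluster_of (V : choiceType) (adj : rel V) (K : pred V) (s : V) :
    set V :=
  [set v | exists p : seq V, [/\ path adj s p, all K (s :: p) & last s p = v]].

Definition site_percolation (R : realType) (d : measure_display)
    (Omega : measurableType d) (P : probability Omega R) (V : choiceType)
    (p : R) (kept : V -> {RV P >-> bool}) : Prop :=
  iid kept (bernoulli_prob p).

(* perc_S(p), computed on a realisation kept of Ber(p)-site percolation; it
   depends only on the joint law of kept. *)
Definition perc (R : realType) (d : measure_display)
    (Omega : measurableType d) (P : probability Omega R) (V : choiceType)
    (adj : rel V) (S : set V) (kept : V -> {RV P >-> bool}) : \bar R :=
  P [set w | exists2 s : V,
       S s & infinite_set (cluster_of adj (fun v => kept v w) s)].

(* Main.v *)
Require Import Defs.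
From mathcomp Require Import all_boot all_order all_algebra finmap.
From mathcomp Require Import all_classical all_reals all_analysis.

Set Implicit Arguments.
Unset Strict Implicit.
Unset Printing Implicit Defensive.

Import Order.TTheory GRing.Theory Num.Theory.
Import numFieldTopology.Exports.

Local Open Scope classical_set_scope.
Local Open Scope ring_scope.

(** Deleting vertices one at a time and discarding sourceless components leaves
    at time [t] exactly the vertices joined to a source by vertices whose clocks
    exceed [t]: whatever is discarded could never be reached again without
    passing through a deleted vertex ([cut_prune], [remainingE]). Hence, for
    [x > 0], separation takes at least time [x] iff a source is joined to a
    target by vertices with [X v >= x] ([separation_time_ge]).

    Each clock is at least [x] with probability [expR (- x)], independently, so
    on [U n] these vertices have the law of the sites of [U n] kept by Bernoulli
    percolation of parameter [expR (- x)]. The probability of an event of a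
    finite window is a finite sum of products depending on the parameter only
    ([pattern_pred_law]), which carries the [n]-th probability over to the one
    percolation space, whatever space the clocks lived on.

    There the event becomes: the cluster of some source has an edge leaving
    [U n] ([crossesP]). These events decrease with [n], and their intersection
    is the existence of an infinite cluster meeting [S]: an infinite cluster
    leaves every finite set, while finitely many finite clusters, together with
    their neighbours, which are finitely many by local finiteness, are
    swallowed by some [U n] ([infinite_clusterP]). Continuity from above
    concludes. *)

(** * The cutting process as a pruned threshold set *)

Section Prune.
Variables (W : finType) (e : rel W) (S : {set W}).
Implicit Types A D : {set W}.

Lemma prune_source A s : s \in S -> s \in A -> s \in prune e S A.
Proof.
move=> sS sA; rewrite inE sA /=; apply/existsP; exists s.
by rewrite inE sS sA connect0.
Qed.

Lemma prune_step A v w :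
  v \in prune e S A -> w \in A -> e v w -> w \in prune e S A.
Proof.
rewrite !inE => /andP[vA /existsP[s /andP[sSA sv]]] wA vw; rewrite wA /=.
apply/existsP; exists s; rewrite sSA /=.
by apply: connect_trans sv (connect1 _); rewrite /= vA wA.
Qed.

(** Together with [prune_source] and [prune_step], this describes [prune] as
    the least set containing the sources in [A] and closed under steps inside
    [A]; inclusions out of [prune] are proved by this induction. *)
Lemma prune_min A D :
    (forall s, s \in S -> s \in A -> s \in D) ->
    (forall v w, v \in D -> w \in A -> e v w -> w \in D) ->
  prune e S A \subset D.
Proof.
move=> srcD stepD; apply/fintype.subsetP => v; rewrite inE => /andP[_].
move=> /existsP[s /andP[]]; rewrite inE => /andP[sS sA] /connectP[p].
have: s \in D by exact: srcD.
elim: p s {sS sA} => [s sD _ -> //|y p IHp s sD /= /andP[/and3P[_ yA sy]]].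
by apply: IHp; exact: stepD sy.
Qed.

Lemma prune_mono A D : A \subset D -> prune e S A \subset prune e S D.
Proof.
move=> /fintype.subsetP AD; apply: prune_min => [s sS /AD|v w vD /AD].
  exact: prune_source.
by move=> wD; exact: prune_step.
Qed.

(** Cutting a vertex after discarding the sourceless components gives the same
    graph as deleting it from the start: a path from a source that avoids [v]
    only meets vertices that were never discarded. *)
Lemma cut_prune A v : Defs.cut e S (prune e S A) v = prune e S (A :\ v)%SET.
Proof.
have AvA : prune e S (A :\ v) \subset prune e S A.
  by apply: prune_mono; exact: subsetDl.
rewrite /Defs.cut; case: ifPn => vA.
- apply/eqP; rewrite finset.eqEsubset; apply/andP; split.
    apply: prune_mono; apply: finset.setSD; apply/fintype.subsetP => w.
    by rewrite inE => /andP[].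
  apply: prune_min => [s sS|u w uA].
    rewrite in_setD1 => /andP[sv sA]; apply: prune_source => //.
    by rewrite in_setD1 sv prune_source.
  rewrite in_setD1 => /andP[wv wA] uw; apply: prune_step (uA) _ (uw).
  rewrite in_setD1 wv; apply: prune_step wA uw.
  by move: uA; rewrite inE in_setD1 => /andP[/andP[]].
- apply/eqP; rewrite finset.eqEsubset AvA andbT.
  apply: prune_min => [s sS sA|u w uAv wA uw].
    apply: prune_source => //; rewrite in_setD1 sA andbT.
    by apply: contraNneq vA => <-; exact: prune_source.
  apply: prune_step (uAv) _ (uw); rewrite in_setD1 wA andbT.
  apply: contraNneq vA => <-; apply: prune_step wA uw.
  exact: (fintype.subsetP AvA).
Qed.

Lemma foldl_cut_prune (l : seq W) A :
  foldl (Defs.cut e S) (prune e S A) l = prune e S (A :\: [set v in l])%SET.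
Proof.
elim: l A => [|v l IHl] A /=.
  by congr prune; apply/setP => w; rewrite !inE.
rewrite cut_prune IHl; congr prune; apply/setP => w.
by rewrite !inE negb_or andbCA andbA.
Qed.

Lemma prune_setT : connected_graph e -> S != finset.set0 ->
  prune e S [set: W] = [set: W]%SET.
Proof.
move=> conn /set0Pn[s sS]; apply/eqP; rewrite -finset.subTset.
apply/fintype.subsetP => v _; have [p + <-] := conn s v.
have: s \in prune e S [set: W] by apply: prune_source; rewrite ?inE.
elim: p s {sS} => [//|y p IHp] s sP /= /andP[sy].
by apply: IHp; apply: prune_step sP _ sy; rewrite inE.
Qed.

End Prune.

Lemma separation_time_ge0 (R : realType) (W : finType) (e : rel W)
  (S T : {set W}) (X : W -> R) : 0 <= separation_time e S T X.
Proof.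
rewrite /separation_time; set D := [set t : R | _].
have [->|/set0P D0] := eqVneq D classical_sets.set0; first by rewrite inf0.
by apply: lb_le_inf => // t [].
Qed.

Section SeparationTime.
Variables (R : realType) (W : finType) (e : rel W) (S T : {set W}).
Hypothesis pruneT : prune e S [set: W] = [set: W]%SET.
Variable X : W -> R.

(** Since each cut only removes one vertex from the pruned set
    ([cut_prune]), the survivors at time [t] depend on the set of clocks that
    have rung and not on their order. *)
Lemma remainingE t : remaining e S X t = prune e S [set v | t < X v]%SET.
Proof.
rewrite /remaining -[X in foldl _ X]pruneT foldl_cut_prune; congr prune.
apply/setP => v.
by rewrite !inE mem_sort mem_filter mem_enum !inE !andbT -ltNge.
Qed.

(** Separation at no time before [x] is the condition for [X v > t] at every
    [t < x]; the finitely many clocks below [x] have a maximum, so some such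
    [t] already gives the set where [X v >= x]. At [x = 0] there is no earlier
    time and the left-hand side always holds, hence the strict hypothesis. *)
Lemma separation_time_ge x : 0 < x ->
  (x <= separation_time e S T X) =
  ~~ [disjoint prune e S [set v | (x <= X v)%R]%SET & T].
Proof.
move=> x0; set D := [set t : R | 0 <= t /\ [disjoint remaining e S X t & T]%B].
have lbD : lbound D 0 by move=> t [].
have hlb : has_lbound D by exists 0.
have D0 : D !=set0.
  (* Once every clock has rung nothing is left. *)
  exists (\big[Num.max/0]_v X v); split; first exact: bigmax_ge_id.
  rewrite remainingE.
  have -> : [set v | \big[Num.max/0]_v X v < X v]%SET = finset.set0.
    by apply/setP => v; rewrite !inE ltNge le_bigmax.
  apply: disjointWl (eq_disjoint0 (A := finset.set0) _ _).
    by apply/fintype.subsetP => v; rewrite !inE.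
  by move=> v; rewrite inE.
apply/idP/idP => [xD|].
- apply/negP => dis.
  (* Between t0 and x no clock rings; the 0 keeps t0 an admissible time. *)
  pose t0 := \big[Num.max/0]_(v | X v < x) X v.
  have t0x : t0 < x by apply/bigmax_ltP; split.
  suff : separation_time e S T X <= t0.
    by move=> /(le_trans xD); rewrite leNgt t0x.
  apply: ge_inf => //; split; first exact: bigmax_ge_id.
  rewrite remainingE; apply: disjointWl dis; apply: prune_mono.
  apply/fintype.subsetP => v; rewrite !inE leNgt; apply: contraTN => vx.
  by rewrite -leNgt; exact: le_bigmax_cond.
- move=> ndis; apply: lb_le_inf => // t [_ dis]; rewrite leNgt.
  apply: contra ndis => tx; apply: disjointWl dis; rewrite remainingE.
  apply/prune_mono/fintype.subsetP => v; rewrite !inE.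
  exact: lt_le_trans.
Qed.

End SeparationTime.

(** * Clusters leaving a finite region *)

Section Clusters.
Variables (V : choiceType) (adj : rel V).
Implicit Types (K : pred V) (A : {fset V}) (S : set V).

Lemma cluster_refl K s : K s -> cluster_of adj K s s.
Proof. by move=> Ks; exists [::]; split => //=; rewrite Ks. Qed.

Lemma cluster_step K s v w :
  cluster_of adj K s v -> K w -> adj v w -> cluster_of adj K s w.
Proof.
move=> [p [sp /= Kp <-]] Kw pw; exists (rcons p w); split.
- by rewrite rcons_path sp.
- by move: Kp; rewrite /= all_rcons Kw.
- by rewrite last_rcons.
Qed.

Lemma cluster_min K s (D : set V) : (K s -> D s) ->
    (forall v w, D v -> K w -> adj v w -> D w) ->
  cluster_of adj K s `<=` D.
Proof.
move=> Ds stepD v [p [sp /= /andP[/Ds {}Ds + <-]]].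
elim: p s sp Ds => [//|y p IHp] s /= /andP[sy yp] Ds /andP[Ky Kp].
by apply: IHp => //; exact: stepD sy.
Qed.

(** Phrasing the crossing of [A] with the whole cluster, not only its part
    inside [A], makes it visibly antitone in [A]. *)
Definition exits K S A : Prop :=
  exists s v w, [/\ S s, cluster_of adj K s v, adj v w & w \notin A].

Lemma exits_antitone K S A A' : (A `<=` A')%fset -> exits K S A' -> exits K S A.
Proof.
move=> /fsubsetP AA' [s [v [w [Ss sv vw wA']]]]; exists s, v, w; split => //.
by apply: contra wA'; exact: AA'.
Qed.

(** The boolean event on the finite region [A]: the set [C] of kept vertices
    joins a source to the inner boundary, which is the whole target set when
    no target is prescribed. *)
Definition crosses S A (C : {set A}) : bool :=
  ~~ [disjoint prune (induced_adj adj A) (source_set S A) C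
       & target_set adj set0 A].

(** A path of kept vertices that leaves [A] sits at an inner boundary vertex
    just before it does so for the first time. *)
Lemma crossesP K S A : S `<=` [set` A] ->
  crosses S [set v : A | K (val v)]%SET <-> exits K S A.
Proof.
move=> SA; split.
- move=> /pred0Pn[/= v /andP[vP]]; rewrite inE in_set0 /=.
  move=> /asboolP[w wA vw].
  pose D :=
    [set u : A | `[< exists2 s, S s & cluster_of adj K s (val u) >]]%SET.
  have PD : prune (induced_adj adj A) (source_set S A)
      [set u : A | K (val u)]%SET \subset D.
    apply: prune_min => [s|u y].
      rewrite !inE => sS Ks; exists (val s) => //; exact: cluster_refl.
    rewrite !inE => -[s Ss su] Ky uy; exists s => //.
    exact: cluster_step uy.
  have := fintype.subsetP PD v vP; rewrite !inE => -[s Ss sv].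
  by exists s, (val v), w.
- move=> [s [v [w [Ss sv vw wA]]]]; apply/negP => dis.
  set P := prune _ _ _ in dis.
  have inner (u : A) y : u \in P -> adj (val u) y -> y \in A.
    move=> uP uy; apply/negPn/negP => yA.
    have /negP := disjointFr dis uP; apply; rewrite inE; apply/orP; right.
    by apply/asboolP; exists y.
  have: ([set` A] `&` [set v | exists2 u : A, u \in P & val u = v]) v.
    apply: cluster_min sv => [Ks|_ y [_ [u uP <-]] Ky uy].
      have sA := SA _ Ss; split => //; exists [` sA]%fset => //.
      by apply: prune_source; rewrite inE //=; apply/mem_set.
    have yA := inner _ _ uP uy; split => //; exists [` yA]%fset => //.
    have yK : [` yA]%fset \in [set v : A | K (val v)]%SET by rewrite inE.
    by apply: prune_step uP yK _.
  by case=> _ [u uP uv]; move: wA; rewrite (inner u)// uv.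
Qed.

(** A cluster without an edge leaving [A] stays in [A], which is finite. *)
Lemma infinite_cluster_exits K S A s : S `<=` [set` A] -> S s ->
  infinite_set (cluster_of adj K s) -> exits K S A.
Proof.
move=> SA Ss inf; apply: contrapT => nex; apply: inf.
apply: sub_finite_set (finite_fset A).
have sub v w : cluster_of adj K s v -> adj v w -> w \in A.
  by move=> sv vw; apply/negPn/negP => wA; apply: nex; exists s, v, w.
move=> v sv; suff [] : ([set` A] `&` cluster_of adj K s) v by [].
apply: cluster_min sv => [Ks|u y [_ su] Ky uy].
  by split; [exact: SA|exact: cluster_refl].
by split; [exact: sub uy|exact: cluster_step uy].
Qed.

(** If all clusters meeting [S] are finite, they and their neighbours fill a
    finite set, which some [U n] contains. *)
Lemma infinite_clusterP K S (U : nat -> {fset V}) :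
    locally_finite adj -> finite_set S -> exhausts adj S U ->
  (exists2 s, S s & infinite_set (cluster_of adj K s)) <->
  forall n, exits K S (U n).
Proof.
move=> locfin finS exU; split.
  by move=> [s Ss inf] n; apply: infinite_cluster_exits inf => //;
    exact: exhausts_source exU n.
move=> ex; apply: contrapT => nex.
pose N := \bigcup_(s in S) \bigcup_(v in cluster_of adj K s) [set w | adj v w].
have finN : finite_set N.
  apply: bigcup_finite => // s Ss; apply: bigcup_finite => [|v _].
    by apply: contrapT => inf; apply: nex; exists s.
  exact: locfin.
have Umono m n : (m <= n)%N -> (U m `<=` U n)%fset.
  move=> /subnK <-; elim: (n - m)%N => [|k IHk]; first by rewrite add0n.
  exact: fsubset_trans IHk (exhausts_mono exU _).
have [n Nn] : exists n, N `<=` [set` U n].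
  pose idx v := proj1_sig (cid (exhausts_cover exU v)).
  exists (\max_(v <- fset_set N) idx v)%N => v Nv /=.
  have idxv : v \in U (idx v) by rewrite /idx; case: cid.
  apply: (fsubsetP (Umono _ _ _)) idxv.
  by apply: leq_bigmax_seq => //; rewrite in_fset_set// inE.
have [s [v [w [Ss sv vw]]]] := ex n.
by move=> /negP; apply; apply: Nn; exists s => //; exists v.
Qed.

End Clusters.

(** * Finite patterns in an i.i.d. field *)

Section Patterns.
Variables (R : realType) (d d' : measure_display) (Omega : measurableType d)
  (E : measurableType d') (P : probability Omega R).
Variables (I : choiceType) (X : I -> {RV P >-> E}) (B : set E) (p : R).
Hypothesis X_indep : mutually_independent X.
Hypothesis B_measurable : measurable B.
Hypothesis X_marginal : forall i, P (X i @^-1` B) = p%:E.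
Variables (W : finType) (h : W -> I).
Hypothesis h_inj : injective h.

(** The reindexing [h] serves fields indexed by a larger, possibly infinite
    set, of which only the finite window [h @` W] is observed. *)
Definition pattern (w : Omega) : {set W} :=
  [set v | `[< B (X (h v) w) >]]%SET.

Let side (C : {set W}) (v : W) : set E := if v \in C then B else ~` B.

Let measurable_preimage i D : measurable D -> measurable (X i @^-1` D).
Proof.
by move=> mD; rewrite -[_ @^-1` _]setTI; exact: measurable_funPT.
Qed.

Let measurable_side C v : measurable (X (h v) @^-1` side C v).
Proof.
apply: measurable_preimage.
by rewrite /side; case: ifP => // _; exact: measurableC.
Qed.

Let pattern_eqE C :
  [set w | pattern w = C] = \bigcap_(v in [set: W]) (X (h v) @^-1` side C v).
Proof.
apply/seteqP; split => w /=.
  move=> <- v _; rewrite /side inE /=; case: ifPn => [/asboolP//|].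
  by move=> /asboolPn.
move=> wC; apply/setP => v; rewrite inE; have := wC v Logic.I.
by rewrite /side /=; case: ifP => _ Bv; apply/asboolP.
Qed.

Lemma measurable_pattern C : measurable [set w | pattern w = C].
Proof.
rewrite pattern_eqE; apply: fin_bigcap_measurable => [|v _].
  exact: finite_finset.
exact: measurable_side.
Qed.

(** The law of the pattern depends on the field only through [p]: this is what
    lets two fields on unrelated probability spaces be compared. *)
Lemma pattern_law C :
  P [set w | pattern w = C] = (\prod_v (if v \in C then p else 1 - p))%:E.
Proof.
pose J := [fset h v | v in W]%fset.
(* Independence needs test sets indexed by I, so [side] is carried along h. *)
pose B' (i : I) := if [exists v, (h v == i) && (v \in C)] then B else ~` B.
have B'h v : B' (h v) = side C v.
  rewrite /B' /side; congr (if _ then _ else _); apply/existsP/idP.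
    by move=> [u /andP[/eqP/h_inj ->]].
  by move=> vC; exists v; rewrite eqxx.
have mB' i : measurable (B' i).
  by rewrite /B'; case: ifP => // _; exact: measurableC.
have := X_indep J mB'.
have -> : \bigcap_(i in [set` J]) (X i @^-1` B' i) = [set w | pattern w = C].
  rewrite pattern_eqE; apply/seteqP; split => w wJ.
    by move=> v _; rewrite -B'h; apply: wJ; rewrite /= in_imfset.
  by move=> i /= /imfsetP[v _ ->]; have := wJ v Logic.I; rewrite -B'h.
move=> ->; rewrite big_imfset/=; last by move=> ? ? _ _; exact: h_inj.
rewrite -prodEFin big_enum /=; apply: eq_bigr => v _; rewrite B'h /side.
case: ifP => // _; rewrite preimage_setC probability_setC ?X_marginal//.
exact: measurable_preimage.
Qed.

Let pattern_pred (F : pred {set W}) :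
  [set w | F (pattern w)] =
  \bigcup_(C in [set C | F C]) [set w | pattern w = C].
Proof.
apply/seteqP; split => w /=; first by exists (pattern w).
by move=> [C /= FC ->].
Qed.

Lemma measurable_pattern_pred (F : pred {set W}) :
  measurable [set w | F (pattern w)].
Proof.
rewrite pattern_pred; apply: fin_bigcup_measurable => [|C _].
  exact: finite_finset.
exact: measurable_pattern.
Qed.

Lemma pattern_pred_law (F : pred {set W}) :
  P [set w | F (pattern w)] =
  (\sum_(C | F C) \prod_v (if v \in C then p else 1 - p))%:E.
Proof.
rewrite pattern_pred measure_fin_bigcup//.
- rewrite -sumEFin -(eq_bigr _ (fun C _ => pattern_law C)).
  apply/esym/bigfs => [|C _]; first exact: index_enum_uniq.
  by rewrite mem_index_enum.
- exact: finite_finset.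
- by move=> C D _ _ [w [/= <- <-]].
- by move=> C _; exact: measurable_pattern.
Qed.

End Patterns.

(** At a nonnegative threshold [x] the density is the derivative of
    [- expR (- rate * z)] beyond [x], and this primitive vanishes at infinity. *)
Lemma exponential_prob_itvcy (R : realType) (rate x : R) : 0 < rate -> 0 <= x ->
  exponential_prob rate `[x, +oo[ = (expR (- rate * x))%:E.
Proof.
move=> rate0 x0.
have cexp : continuous (fun z : R^o => expR (- rate * z)).
  move=> z; apply: continuous_comp; last exact: continuous_expR.
  apply: continuousM => //; apply: (@continuousN _ R^o).
  exact: cst_continuous.
rewrite /exponential_prob (@ge0_continuous_FTC2y _ _
  (fun z => - (expR (- rate * z))) _ 0)//.
- by rewrite EFinN oppeK add0e.
- by move=> z _; apply: exponential_pdf_ge0; exact: ltW.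
- apply: (@continuous_subspaceW R^o _ _ [set` `[0, +oo[%R]).
    by apply: subset_itvr; rewrite bnd_simp.
  exact: within_continuous_exponential_pdf.
- rewrite -oppr0; apply: cvgN.
  rewrite (_ : (fun z => expR (- rate * z)) =
               (fun z => expR (- z)) \o (fun z => rate * z)); last first.
    by apply: eq_fun => z; rewrite mulNr.
  apply: (@cvg_comp _ _ _ _ _ _ (pinfty_nbhs R)); last exact: cvgr_expR.
  exact: gt0_cvgMry.
- by apply: cvgN; apply/cvg_at_right_filter; exact: cexp.
- move=> z; rewrite in_itv /= andbT => xz; apply: derive1_exponential_pdf.
  by rewrite in_itv /= andbT (le_lt_trans x0).
Qed.

(** * Convergence *)

Theorem proposition8 (R : realType)
  (V : choiceType) (adj : rel V)
  (adj_sym : symmetric adj) (adj_irr : irreflexive adj)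
  (G_locfin : locally_finite adj)
  (G_infinite : infinite_set [set: V])
  (G_connected : connected_graph adj)
  (S : set V) (S_finite : finite_set S) (S_nonempty : S !=set0)
  (U : nat -> {fset V}) (U_exhausts : exhausts adj S U)
  (d : nat -> measure_display) (Omega : forall n, measurableType (d n))
  (P : forall n, probability (Omega n) R)
  (X : forall n, U n -> {RV (P n) >-> R})
  (X_iid : forall n, iid (X n) (exponential_prob (1 : R)))
  (x : R) (x_ge0 : 0 <= x)
  (d' : measure_display) (Omega' : measurableType d')
  (Q : probability Omega' R) (kept : V -> {RV Q >-> bool})
  (kept_perc : site_percolation (expR (- x)) kept) :
  (fun n => P n [set w | x <= separation_time
                               (induced_adj adj (U n))
                               (source_set S (U n))
                               (target_set adj set0 (U n))
                               (fun v => X n v w)])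
    @ \oo --> perc adj S kept.
Proof.
have SU n : S `<=` [set` U n] by exact: exhausts_source U_exhausts n.
set p := expR (- x) in kept_perc.
have p01 : 0 <= p <= 1 by rewrite expR_ge0 /p expR_le1 oppr_le0.
pose F n : pred {set U n} := crosses adj S (A := U n).
pose A n := [set w | exits adj (fun v => kept v w) S (U n)].
have AE n : A n = [set w | F n (pattern kept [set true] val w)].
  have KE w : pattern kept [set true] val w =
      [set v : U n | kept (val v) w]%SET.
    by apply/setP => v; rewrite !finset.inE; apply/asboolP/idP.
  have crE w := crossesP adj (fun v => kept v w) (SU n).
  by apply/seteqP; split => w /=; rewrite /F KE; apply crE.
have kept1 v : Q (kept v @^-1` [set true]) = p%:E.
  have [/(_ v [set true]) H _] := kept_perc; rewrite [LHS]H//.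
  rewrite bernoulli_probE// !diracE.
  by rewrite mem_set// memNset// mule1 mule0 adde0.
have X1 n i : P n (X n i @^-1` `[x, +oo[) = p%:E.
  have [/(_ i `[x, +oo[%classic) H _] := X_iid n; rewrite [LHS]H//.
  by rewrite exponential_prob_itvcy// mulN1r.
have mA n : measurable (A n).
  by rewrite AE; exact: measurable_pattern_pred.
have [s0 Ss0] := S_nonempty.
(* With every vertex kept, the cluster of a source is the infinite graph. *)
have crosses_setT n : F n [set: U n]%SET.
  have -> : [set: U n]%SET = [set v : U n | predT (val v)]%SET.
    by apply/setP => v; rewrite !finset.inE.
  apply/(crossesP adj predT (SU n)).
  apply: infinite_cluster_exits (SU n) Ss0 _.
  suff -> : cluster_of adj predT s0 = [set: V] by [].
  apply/seteqP; split => // v _; have [q s0q qv] := G_connected s0 v.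
  by exists q; split => //; exact/allP.
have PXE n : P n [set w | F n (pattern (X n) `[x, +oo[ id w)] = Q (A n).
  rewrite AE (pattern_pred_law (X_iid n).2 _ (X1 n))//.
  by rewrite (pattern_pred_law kept_perc.2 _ kept1)//; exact: val_inj.
have PE n : P n [set w | x <= separation_time (induced_adj adj (U n))
    (source_set S (U n)) (target_set adj set0 (U n)) (fun v => X n v w)] =
    Q (A n).
  (* At x = 0 the event on the left is certain, while the crossing event is
     so only almost surely: negative clocks have probability 0 but can
     prevent it. *)
  rewrite -PXE; move: x_ge0; rewrite le_eqVlt => /predU1P[x0|x_gt0].
    rewrite [in LHS](_ : [set w | _] = setT); last first.
      by apply/seteqP; split => // w _ /=; rewrite -x0 separation_time_ge0.
    rewrite probability_setT; apply/esym/eqP; rewrite eq_le probability_le1 /=.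
      have p1 : p = 1 by rewrite /p -x0 oppr0 expR0.
      have <- : P n [set w | pattern (X n) `[x, +oo[ id w = [set: U n]%SET]
          = 1%E.
        rewrite (pattern_law (X_iid n).2 _ (X1 n))// big1// => v _.
        by rewrite finset.inE.
      apply: le_measure; rewrite ?inE; last by move=> w /= ->.
        exact: measurable_pattern.
      exact: measurable_pattern_pred.
    exact: measurable_pattern_pred.
  have pruneT : prune (induced_adj adj (U n)) (source_set S (U n))
      [set: U n]%SET = [set: U n]%SET.
    apply: prune_setT; first exact: (exhausts_connected U_exhausts (n := n)).
    apply/set0Pn; exists [` SU n s0 Ss0]%fset.
    by rewrite finset.inE /=; exact: mem_set.
  have patE w : pattern (X n) `[x, +oo[ id w = [set v | x <= X n v w]%SET.
    apply/setP => v; rewrite !finset.inE /= in_itv /= andbT.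
    by apply/asboolP/idP.
  congr (P n _); apply/funext => w /=.
  by rewrite (separation_time_ge _ pruneT)// patE.
under eq_fun do rewrite PE.
have -> : perc adj S kept = Q (\bigcap_n A n).
  congr (Q _); apply/seteqP; split => w /=.
    move=> /(infinite_clusterP _ G_locfin S_finite U_exhausts) Aw n _.
    exact: Aw.
  move=> Aw; apply/(infinite_clusterP _ G_locfin S_finite U_exhausts) => n.
  exact: Aw.
apply: nonincreasing_cvg_mu => //.
- by rewrite (le_lt_trans (probability_le1 _ _))// ltry.
- exact: bigcapT_measurable.
- apply/nonincreasing_seqP => n; apply/subsetPset => w.
  exact: exits_antitone (exhausts_mono U_exhausts n).
Qed.
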